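(* Let $k,l\in\{0,1,\ldots,N\}$, and let $\mu_k^l$ be the law of $\chi_l$ conditioned on $\kappa=k$, i.e. the distribution of $\chi_l(\sigma)$ when $\sigma$ is chosen uniformly at random in $\{\sigma\in\widetilde{S}_N:\kappa(\sigma)=k\}$. Then $$\mu_k^l=\sum_{q\geq0}\binom{k}{q}\binom{l}{q}\binom{N}{q}^{-2}\frac{(\delta_1-\delta_0)^{*q}}{q!},$$ and, for fixed $s,t\in(0,1]$, in the limit $k=sN$, $l=tN$, $N\to\infty$ the measures $\mu_k^l$ converge to the Poisson law of parameter $st$.
   Context: $\widetilde{S}_N$ is the set of partial permutations of $\{1,\ldots,N\}$, i.e. bijections $\sigma:X\to Y$ between subsets $X,Y\subset\{1,\ldots,N\}$ (the empty one included). $\kappa(\sigma)=|X|=|Y|$ is the cardinality of the domain/range. For $l\leq N$, $\chi_l(\sigma)$ is the number of fixed points of $\sigma$ among $\{1,\ldots,l\}$, i.e. the number of $i\le l$ with $i\in X$ and $\sigma(i)=i$. $\delta_a$ is the Dirac mass at $a$, and $(\cdot)^{*q}$ is the $q$-th convolution power of a signed measure on $\mathbb R$ (with $(\cdot)^{*0}=\delta_0$); the summand is zero when $q>\min(k,l)$. In the limit, $N$ runs over integers for which $sN,tN$ are integers, and convergence is convergence in distribution. *)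

(* Defs.v *)
From HB Require Import structures.
From mathcomp Require Import all_boot all_order all_algebra.
From mathcomp Require Import all_classical all_reals all_analysis.

Set Implicit Arguments.
Unset Strict Implicit.
Unset Printing Implicit Defensive.

Import Order.TTheory GRing.Theory Num.Theory.
Import numFieldNormedType.Exports.

Local Open Scope classical_set_scope.
Local Open Scope ring_scope.

(* {1, ..., N} is encoded as 'I_N = {0, ..., N-1}; {1, ..., l} is i < l. *)
Definition pdom (N : nat) (f : {ffun 'I_N -> option 'I_N}) : {set 'I_N} :=
  [set i | isSome (f i)]%SET.

(* A bijection from X to Y amounts to an option-valued map that is injective on
   the set X where it is not None; Y is then the image of X. *)
Definition pperm (N : nat) :=
  {f : {ffun 'I_N -> option 'I_N} | dinjectiveb f (pdom f)}.

HB.instance Definition _ (N : nat) := Finite.on (pperm N).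

Definition kappa (N : nat) (s : pperm N) : nat := #|pdom (val s)|.

Definition chi (N l : nat) (s : pperm N) : nat :=
  #|[set i : 'I_N | (i < l)%N && (val s i == Some i)]%SET|.

Fact pperm0_subproof (N : nat) :
  dinjectiveb [ffun _ : 'I_N => None : option 'I_N] (pdom [ffun => None]).
Proof. by apply/dinjectiveP => i j; rewrite inE ffunE. Qed.

HB.instance Definition _ (N : nat) :=
  isPointed.Build (pperm N) (exist _ [ffun => None] (pperm0_subproof N)).

HB.instance Definition _ (N : nat) :=
  @isMeasurable.Build default_measure_display (pperm N)
    discrete_measurable discrete_measurable0 discrete_measurableC
    discrete_measurableU.

Definition pushforward_measure {d d'} {T : measurableType d}
    {T' : measurableType d'} {R : realType} (m : {measure set T -> \bar R})
    (f : T -> T') (mf : measurable_fun setT f) : {measure set T' -> \bar R}.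
Proof. by refine (pushforward m f). Defined.

Section law.
Context {R : realType}.
Variables N k l : nat.

Definition kappa_eq : set (pperm N) := [set s | kappa s = k].

Fact measurable_kappa_eq : measurable kappa_eq.
Proof. by []. Qed.

(* For k <= N this is the uniform probability on the partial permutations with
   kappa = k; it is the zero measure otherwise. *)
Definition uniform_kappa : {measure set (pperm N) -> \bar R} :=
  mscale (#|[set s : pperm N | kappa s == k]%SET|%:R^-1 : R)%:nng
    (mrestr counting measurable_kappa_eq).

Fact measurable_chi : measurable_fun setT (fun s : pperm N => (chi l s)%:R : R).
Proof. by []. Qed.

Definition chi_law : {measure set R -> \bar R} :=
  pushforward_measure uniform_kappa measurable_chi.

End law.

Section convolution.
Local Open Scope ereal_scope.
Context {R : realType}.

Fact measurable_addR : measurable_fun setT (fun z : R * R => (z.1 + z.2)%R).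
Proof.
apply: measurable_realfun.measurable_funD.
  exact: measurable_fst.
exact: measurable_snd.
Qed.

Section finite_measures.
Variables m1 m2 : {finite_measure set R -> \bar R}.

Definition conv_measure : set R -> \bar R :=
  pushforward_measure (m1 \x m2) measurable_addR.

HB.instance Definition _ := Measure.on conv_measure.

Let conv_measure_fin : fin_num_fun conv_measure.
Proof.
apply: lty_fin_num_fun.
have mT : conv_measure setT = m1 setT * m2 setT.
  have := @product_measure1E _ _ _ _ R m1 m2 setT setT measurableT measurableT.
  by rewrite setXTT.
rewrite [X in X < _]mT ltey_eq fin_numM//; exact: fin_num_measure.
Qed.

HB.instance Definition _ :=
  Measure_isFinite.Build _ _ _ conv_measure conv_measure_fin.

End finite_measures.

Section jordan_parts.
Variable n : {charge set R -> \bar R}.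

Fact hahn_sets : {P : set R & {N : set R | hahn_decomposition n P N}}.
Proof. by have /cid[P /cid[N PN]] := Hahn_decomposition n; exists P, N. Qed.

Definition pos_part : {finite_measure set R -> \bar R} :=
  jordan_pos (svalP (projT2 hahn_sets)).

Definition neg_part : {finite_measure set R -> \bar R} :=
  jordan_neg (svalP (projT2 hahn_sets)).

End jordan_parts.

(* The image under addition of the product n1 x n2 of signed measures, the
   product being expanded bilinearly in the Jordan decompositions. *)
Definition conv (n1 n2 : {charge set R -> \bar R}) :
    {charge set R -> \bar R} :=
  let c m1 m2 := charge_of_finite_measure (conv_measure m1 m2) in
  cadd (cadd (c (pos_part n1) (pos_part n2)) (c (neg_part n1) (neg_part n2)))
    (copp (cadd (c (pos_part n1) (neg_part n2)) (c (neg_part n1) (pos_part n2)))).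

Fixpoint conv_pow (n : {charge set R -> \bar R}) (q : nat) :
    {charge set R -> \bar R} :=
  if q is q'.+1 then conv n (conv_pow n q')
  else charge_of_finite_measure \d_(0%R : R).

End convolution.

Section convergence_in_distribution.
Context {R : realType}.

Definition cvg_in_law {I : Type} (F : set_system I)
    (mu_ : I -> {measure set R -> \bar R}) (nu : {measure set R -> \bar R}) :=
  forall f : R -> R, continuous f -> bounded_fun f ->
    (\int[mu_ i]_x (f x)%:E)%E @[i --> F] --> (\int[nu]_x (f x)%:E)%E.

Fact measurable_natr : measurable_fun setT (fun n : nat => n%:R : R).
Proof. by []. Qed.

(* The nat argument 0 of poisson_prob is ignored by the library definition. *)
Definition poisson_law (rate : R) : {measure set R -> \bar R} :=
  pushforward_measure (poisson_prob rate 0) measurable_natr.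

End convergence_in_distribution.

(* Main.v *)
Require Import Defs.
From HB Require Import structures.
From mathcomp Require Import all_boot all_order all_fingroup all_algebra.
From mathcomp Require Import all_classical all_reals all_analysis.
From mathcomp Require Import measurable_realfun ring lra.

(** Partial permutations with [kappa = k] are counted through their factorial
    moments.  For a set [S] of [q] points let [M S] be the number of those that
    fix every point of [S].  Composing on both sides with transpositions that
    leave [S] alone shows that, among them, the number with [x |-> y] is the
    same for all [x], [y] outside [S]; counting pairs [(x, y)] in two ways
    gives [(N - q)^2 * M (x |: S) = (k - q) * M S] ([sum_fixing_at],
    [card_fixing]).  Hence the mean of ['C(chi, q)] is
    ['C(l, q) * k ^_ q / (N ^_ q)^2], which is the coefficient of the stated
    expansion ([chi_mean_bin]).

    Newton's forward-difference formula [g n = sum_q 'C(n, q) (D^q g)(0)] turns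
    these moments into the mean of [g chi] for every [g] ([chi_mean_newton]).
    For [g n = 1_A(n)] that mean is the law of [chi] at [A], and
    [(D^q 1_A)(0)] is the value at [A] of the convolution power
    [(d_1 - d_0)^{*q}]: convolving any charge with [d_1 - d_0] takes the
    difference of its translate by 1 and itself ([conv_unit_step]).  This is the
    expansion.

    For the limit, taking [g] to be the indicator of [j] writes the probability
    of [chi = j] as an alternating sum whose [q]-th coefficient tends to
    [(st)^q / q!] and is at most [1 / q!].  Dominated convergence for series
    ([tannery]) gives the Poisson weight of [j] in the limit.  As the probability
    of [chi = j] is at most the mean of ['C(chi, j)], hence at most [1 / j!],
    the same theorem applied to [sum_j f(j) P(chi = j)] gives convergence of the
    integrals of bounded continuous functions. *)

Set Implicit Arguments.
Unset Strict Implicit.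
Unset Printing Implicit Defensive.

Import Order.TTheory GRing.Theory Num.Theory.
Import numFieldNormedType.Exports.

Local Open Scope ring_scope.

(** * Partial permutations fixing a given set *)

Section counting_partial_permutations.
Import mathcomp.boot.fintype mathcomp.boot.finset.
Variable N : nat.
Implicit Types (s : pperm N) (S : {set 'I_N}).
Local Open Scope nat_scope.

Lemma mem_pdom s i : (i \in pdom (val s)) = isSome (val s i).
Proof. by rewrite inE. Qed.

Lemma pperm_inj s i j y : val s i = Some y -> val s j = Some y -> i = j.
Proof.
by move=> si sj; have /dinjectiveP := valP s; apply; rewrite ?mem_pdom ?si ?sj.
Qed.

Fact twist_subproof (p r : {perm 'I_N}) s :
  let f := [ffun i => omap p (val s (r i))] in dinjectiveb f (pdom f).
Proof.
apply/dinjectiveP => i j; rewrite !inE !ffunE.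
case si : (val s (r i)) => [a|]//= _; case sj : (val s (r j)) => [b|]//= _.
move=> [/perm_inj ab]; apply: (@perm_inj _ r).
by apply: (pperm_inj si); rewrite ab.
Qed.

(** Two-sided composition with permutations: the symmetry that makes all points
    outside the fixed set play the same role. *)
Definition twist (p r : {perm 'I_N}) s : pperm N :=
  exist _ [ffun i => omap p (val s (r i))] (twist_subproof p r s).

Lemma twistE p r s i : val (twist p r s) i = omap p (val s (r i)).
Proof. by rewrite ffunE. Qed.

Lemma twist_inj p r : injective (twist p r).
Proof.
move=> s s' ss'; apply/val_inj/ffunP => i.
have := congr1 (fun u : pperm N => val u (r^-1%g i)) ss'; rewrite !twistE permKV.
by case: (val s i) (val s' i) => [a|] [b|] //= [/perm_inj ->].
Qed.

Lemma kappa_twist p r s : kappa (twist p r s) = kappa s.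
Proof.
rewrite /kappa -[RHS](card_preimset (pdom (val s)) (@perm_inj _ r)).
apply: eq_card => i; rewrite !inE twistE.
by case: (val s (r i)).
Qed.

Definition fixing k S : {set pperm N} :=
  [set s | (kappa s == k) && [forall i in S, val s i == Some i]].

Definition fixing_at k S x y : {set pperm N} :=
  [set s in fixing k S | val s x == Some y].

Lemma twist_tperm_fixing k S x y x' y' s :
  x \notin S -> y \notin S -> x' \notin S -> y' \notin S ->
  s \in fixing_at k S x y ->
  twist (tperm y y') (tperm x x') s \in fixing_at k S x' y'.
Proof.
move=> xS yS xS' yS'; rewrite !inE kappa_twist.
move=> /andP[/andP[-> /'forall_implyP fS] sx].
rewrite !twistE tpermR (eqP sx)/= tpermL eqxx andbT.
apply/'forall_implyP => i iS; rewrite twistE.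
have neqS z : z \notin S -> z != i by apply: contraNneq => ->.
by rewrite tpermD ?neqS// (eqP (fS i iS))/= tpermD ?neqS.
Qed.

(** Twisting by the transpositions of [y], [y'] and of [x], [x'], all of which
    lie outside [S], carries either set into the other. *)
Lemma card_fixing_at k S x y x' y' :
  x \notin S -> y \notin S -> x' \notin S -> y' \notin S ->
  #|fixing_at k S x y| = #|fixing_at k S x' y'|.
Proof.
move=> xS yS xS' yS'.
have le z w z' w' : z \notin S -> w \notin S -> z' \notin S -> w' \notin S ->
    #|fixing_at k S z w| <= #|fixing_at k S z' w'|.
  move=> zS wS zS' wS'.
  rewrite -(card_imset _ (@twist_inj (tperm w w') (tperm z z'))).
  apply/subset_leq_card/subsetP => _ /imsetP[s sin ->].
  exact: twist_tperm_fixing.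
by apply/eqP; rewrite eqn_leq !le.
Qed.

Lemma fixingU1 k S x : fixing k (x |: S) = fixing_at k S x x.
Proof.
apply/setP => s; rewrite !inE -andbA; congr (_ && _).
apply/'forall_implyP/andP => [fS|[/'forall_implyP fS sx] i].
  split; last by apply: fS; rewrite setU11.
  by apply/'forall_implyP => i iS; apply: fS; rewrite setU1r.
by rewrite !inE => /orP[/eqP->//|]; exact: fS.
Qed.

(** Exchanging the sums, each [s] fixing [S] counts the points of its domain
    outside [S]: by injectivity their images lie outside [S] as well. *)
Lemma sum_fixing_at k S :
  \sum_(x in ~: S) \sum_(y in ~: S) #|fixing_at k S x y| =
  #|fixing k S| * (k - #|S|).
Proof.
transitivity (\sum_(x in ~: S) \sum_(y in ~: S)
    \sum_(s in fixing k S) (val s x == Some y : nat)).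
  apply: eq_bigr => x _; apply: eq_bigr => y _.
  rewrite -sum1_card big_mkcond [RHS]big_mkcond/=; apply: eq_bigr => s _.
  by rewrite inE; case: (s \in _) => //=; case: eqP.
under eq_bigr do rewrite exchange_big/=.
rewrite exchange_big/= -sum_nat_const; apply: eq_bigr => s.
rewrite inE => /andP[/eqP kk /'forall_implyP fS].
have Sdom : S \subset pdom (val s).
  by apply/subsetP => i iS; rewrite mem_pdom (eqP (fS i iS)).
rewrite -kk /kappa -cardsDS// -sum1_card.
rewrite [RHS]big_mkcond [LHS]big_mkcond/=; apply: eq_bigr => x _.
rewrite !inE; case: ifPn => //= xS.
case sx : (val s x) => [y|]/=; last by rewrite big1.
have yS : y \in ~: S.
  rewrite inE; apply: contra xS => yS.
  by rewrite (pperm_inj sx (eqP (fS y yS))).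
rewrite (bigD1 y)//= eqxx big1// => z /andP[_ /negbTE zy].
by case: eqP => // -[]/eqP; rewrite eq_sym zy.
Qed.

(** Adjoining a point [x] to a set [T] of [q] points: the [(N - q)^2] summands of
    [sum_fixing_at] are all equal to [#|fixing k (x |: T)|], hence a recursion
    on [q]. *)
Lemma card_fixing k S :
  #|fixing k S| * (N ^_ #|S|) ^ 2 = k ^_ #|S| * #|fixing k set0|.
Proof.
have [n Sn] := ubnP #|S|; elim: n S Sn => // n IHn S Sn.
have [->|[x xS]] := set_0Vmem S; first by rewrite cards0 mulnC.
have [T xT ST] : exists2 T : {set 'I_N}, x \notin T & S = x |: T.
  by exists (S :\ x); [rewrite !inE eqxx|rewrite setD1K].
rewrite {}ST in Sn xS *; have {}Sn : #|T| < n by move: Sn; rewrite cardsU1 xT.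
have := sum_fixing_at k T.
have -> : \sum_(z in ~: T) \sum_(y in ~: T) #|fixing_at k T z y| =
    (N - #|T|) ^ 2 * #|fixing k (x |: T)|.
  rewrite fixingU1.
  under eq_bigr => z zT.
    under eq_bigr => y yT.
      rewrite (@card_fixing_at _ _ _ _ x x) ?xT//; last 2 first.
      by move: zT; rewrite inE.
      by move: yT; rewrite inE.
    over.
  rewrite sum_nat_const; over.
  by rewrite sum_nat_const mulnA mulnn cardsCs setCK card_ord.
move=> eT; rewrite cardsU1 xT add1n !ffactnSr expnMn mulnCA.
by rewrite [#|_| * _]mulnC eT mulnA [_ ^ 2 * _]mulnC IHn// mulnAC.
Qed.

Lemma fixing_gt0 k : k <= N -> 0 < #|fixing k set0|.
Proof.
move=> kN.
(* The identity of the first [k] points is such a partial permutation. *)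
pose f := [ffun i : 'I_N => if i < k then Some i else None].
have fK : dinjectiveb f (pdom f).
  apply/dinjectiveP => i j; rewrite !inE !ffunE.
  by case: ifP => // _ _; case: ifP => // _ _ [].
apply/card_gt0P; exists (exist _ f fK); rewrite inE; apply/andP; split; last first.
  by apply/'forall_implyP => i; rewrite inE.
rewrite /kappa/=.
have -> : pdom f = [set widen_ord kN i | i : 'I_k].
  apply/setP => i; rewrite !inE ffunE; apply/idP/imsetP => [|[j _ ->]].
    by case: ifP => // ik _; exists (Ordinal ik) => //; apply/val_inj.
  by rewrite /= ltn_ord.
by rewrite card_imset ?card_ord// => i j /(congr1 val)/= /val_inj.
Qed.

(** ['C(chi l s, q)] is the number of [q]-subsets of [{0, ..., l - 1}] fixed
    pointwise by [s]; exchanging sums leaves ['C(l, q)] equal terms. *)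
Lemma sum_bin_chi k l q : l <= N ->
  (\sum_(s : pperm N | kappa s == k) 'C(chi l s, q)) * (N ^_ q) ^ 2 =
  'C(l, q) * k ^_ q * #|fixing k set0|.
Proof.
move=> lN.
pose L := [set i : 'I_N | i < l].
have cL : #|L| = l.
  have -> : L = [set widen_ord lN i | i : 'I_l].
    apply/setP => i; rewrite !inE; apply/idP/imsetP => [il|[j _ ->]].
      by exists (Ordinal il) => //; apply/val_inj.
    by rewrite /= ltn_ord.
  by rewrite card_imset ?card_ord// => i j /(congr1 val)/= /val_inj.
have -> : \sum_(s : pperm N | kappa s == k) 'C(chi l s, q) =
    \sum_(S : {set 'I_N} | (S \subset L) && (#|S| == q)) #|fixing k S|.
  under [RHS]eq_bigr do rewrite -sum1dep_card.
  rewrite (exchange_big_dep (fun s : pperm N => kappa s == k))/=; last first.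
    by move=> S s _ /andP[].
  apply: eq_bigr => s kk; rewrite /chi -cards_draws -sum1dep_card.
  apply: eq_bigl => S; rewrite kk/= andbAC; congr (_ && _).
  apply/subsetP/andP => [sub|[/subsetP SL /'forall_implyP fS] i iS].
    split; first by apply/subsetP => i /sub; rewrite !inE => /andP[].
    by apply/'forall_implyP => i /sub; rewrite !inE => /andP[].
  by rewrite inE fS// andbT; have := SL _ iS; rewrite inE.
rewrite big_distrl/=.
rewrite (eq_bigr (fun=> k ^_ q * #|fixing k set0|)); last first.
  by move=> S /andP[_ /eqP <-]; exact: card_fixing.
by rewrite sum_nat_cond_const cards_draws cL mulnA.
Qed.

End counting_partial_permutations.

Local Open Scope classical_set_scope.

(** * Forward differences *)

Section finite_differences.
Variable R : pzRingType.
Implicit Types (g : nat -> R).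

Definition fdiff g := fun n => g n.+1 - g n.

(** Any [m >= n] may bound the sum, so that a single range serves all the values
    of a bounded random variable. *)
Lemma newton_expansion g n m : (n <= m)%N ->
  g n = \sum_(q < m.+1) 'C(n, q)%:R * iter q fdiff g 0%N.
Proof.
elim: n g m => [|n IHn] g m nm.
  by rewrite big_ord_recl bin0 mul1r big1 ?addr0// => i _; rewrite bin0n mul0r.
case: m nm => // m nm.
transitivity (g n + fdiff g n); first by rewrite addrC subrK.
rewrite (IHn g m.+1) 1?ltnW// (IHn (fdiff g) m)//.
rewrite big_ord_recl [RHS]big_ord_recl !bin0 -addrA -big_split/=; congr (_ + _).
by apply: eq_bigr => i _; rewrite -iterSr binS natrD mulrDl.
Qed.

Lemma fdiff_succ q g n :
  iter q fdiff (fun i => g i.+1) n = iter q fdiff g n.+1.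
Proof. by elim: q n => //= q IHq n; rewrite /fdiff !IHq. Qed.

(** The differences at 0 do not suffice for an induction on [q], so the value is
    computed at every [n]: for [n <= j] it is the one at 0 for the indicator of
    [j - n]. *)
Lemma fdiff_indicator q j :
  iter q fdiff (fun n => (n == j)%:R) 0%N = (-1) ^+ (q + j) * 'C(q, j)%:R :> R.
Proof.
suff H n : iter q fdiff (fun n => (n == j)%:R) n =
    (n <= j)%N%:R * ((-1) ^+ (q + (j - n)) * 'C(q, j - n)%:R) :> R.
  by rewrite H mul1r subn0.
elim: q n => [|q IHq] n /=.
  rewrite bin0n subn_eq0 add0n; case: ltngtP => [nj|nj|->]; rewrite ?mul0r ?mulr0//.
  by rewrite subnn !mulr1.
rewrite /fdiff !IHq; case: (ltngtP n j) => [nj|nj|->]; rewrite ?mul0r ?subrr//.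
  rewrite !mul1r -(subnSK nj) binS natrD mulrDr; set d := (j - n.+1)%N.
  by rewrite addSn addnS !exprS !mulN1r opprK !mulNr opprK addrC.
by rewrite subnn !bin0 !mulr1 !mul1r sub0r !addn0 exprS mulN1r.
Qed.

End finite_differences.

(** * Factorial moments of the number of fixed points *)

Definition factorial_coeff (R : realType) N k l q : R :=
  'C(k, q)%:R * 'C(l, q)%:R * 'C(N, q)%:R ^- 2 / q`!%:R.

(** Here ['C(N, q) = 0], whose inverse is 0. *)
Lemma factorial_coeff_eq0 (R : realType) N k l q : (N < q)%N ->
  factorial_coeff R N k l q = 0.
Proof.
by move=> Nq; rewrite /factorial_coeff (bin_small Nq) expr0n invr0 mulr0 !mul0r.
Qed.

(** [fixing k set0] is the set of all [s] with [kappa s = k], so this is the mean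
    of [g] under the uniform law on it. *)
Definition pperm_mean (R : realType) N k (g : pperm N -> R) : R :=
  #|fixing k (@finset.set0 'I_N)|%:R^-1 * \sum_(s : pperm N | kappa s == k) g s.

Definition chi_mean (R : realType) N k l (g : nat -> R) : R :=
  pperm_mean k (fun s : pperm N => g (chi l s)).

Section mean_of_chi.
Variable R : realType.
Variables N k l : nat.
Hypotheses (kN : (k <= N)%N) (lN : (l <= N)%N).

Lemma factorial_coeff_ffact q :
  factorial_coeff R N k l q = ('C(l, q) * k ^_ q)%:R / (N ^_ q)%:R ^+ 2.
Proof.
rewrite /factorial_coeff -!bin_ffact !natrM exprMn.
have q0 : q`!%:R != 0 :> R by rewrite pnatr_eq0 -lt0n fact_gt0.
by rewrite !invfM; move: ('C(N, q)%:R^-1) => c; field.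
Qed.

(** [sum_bin_chi] divided by [(N ^_ q) ^ 2]; this is 0 for [q > N], where both
    sides vanish. *)
Lemma chi_mean_bin q :
  chi_mean N k l (fun n => 'C(n, q)%:R) = factorial_coeff R N k l q.
Proof.
rewrite /chi_mean /pperm_mean -natr_sum factorial_coeff_ffact.
have M0 : #|fixing k (@finset.set0 'I_N)|%:R != 0 :> R.
  by rewrite pnatr_eq0 -lt0n fixing_gt0.
have [qN|Nq] := leqP q N; last first.
  rewrite (ffact_small Nq) expr0n/= invr0 mulr0 big1 ?mulr0// => s _.
  apply: bin_small; apply: leq_ltn_trans Nq.
  by rewrite -[leqRHS]card_ord max_card.
have F0 : (N ^_ q)%:R ^+ 2 != 0 :> R.
  by rewrite expf_neq0// pnatr_eq0 -lt0n ffact_gt0.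
apply: (canLR (mulKf M0)); rewrite mulrA; apply: (canRL (mulfK F0)).
by rewrite -natrX -!natrM sum_bin_chi// mulnC.
Qed.

Lemma chi_mean_newton (g : nat -> R) :
  chi_mean N k l g =
  \sum_(q < N.+1) factorial_coeff R N k l q * iter q (@fdiff R) g 0%N.
Proof.
rewrite /chi_mean /pperm_mean.
under eq_bigr => s _.
  rewrite (@newton_expansion _ g _ N); last first.
    by rewrite -[leqRHS]card_ord max_card.
  over.
rewrite exchange_big mulr_sumr; apply: eq_bigr => q _.
by rewrite -big_distrl/= mulrA -chi_mean_bin.
Qed.

End mean_of_chi.

Lemma counting_finType (R : realType) (T : finType) (A : set T) :
  counting A = (\sum_(x : T) \1_A x : R)%:E.
Proof.
rewrite /counting asboolT; last exact: finite_finset.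
under [in RHS]eq_bigr do rewrite indicE.
rewrite -natr_sum -big_mkcond/= sum1_card.
congr (_%:R%:E); rewrite cardE; apply/perm_size/uniq_perm.
- exact: finmap.fset_uniq.
- exact: enum_uniq.
by move=> x; rewrite in_fset_set ?mem_enum//; exact: finite_finset.
Qed.

Lemma uniform_kappaE (R : realType) N k (A : set (pperm N)) :
  uniform_kappa N k A = (pperm_mean k (\1_A : pperm N -> R))%:E.
Proof.
rewrite /uniform_kappa/= /mscale/= /mrestr counting_finType EFinM.
congr ((_%:R^-1)%:E * _%:E)%E.
  apply: eq_card => s; rewrite !inE; case: eqP => //= _.
  by apply/esym/'forall_implyP => i; rewrite inE.
rewrite [RHS]big_mkcond/=; apply: eq_bigr => s _; rewrite !indicE in_setI.
rewrite [X in _ && X](_ : _ = (kappa s == k)); last first.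
  by apply/idP/eqP; rewrite inE.
by case: (_ == _); rewrite ?andbT ?andbF.
Qed.

Lemma chi_lawE (R : realType) N k l (A : set R) :
  chi_law N k l A = (chi_mean N k l (fun n => \1_A n%:R : R))%:E.
Proof. exact: uniform_kappaE. Qed.


(** * Convolution powers of the unit step *)

Section convolution_with_unit_step.
Local Open Scope ereal_scope.
Variable R : realType.

Definition unit_step : {charge set R -> \bar R} :=
  cadd (charge_of_finite_measure \d_(1%R : R))
       (copp (charge_of_finite_measure \d_(0%R : R))).

(** The Jordan decomposition, for whichever Hahn sets were chosen. *)
Lemma charge_pos_neg_part (n : {charge set R -> \bar R}) (A : set R) :
  measurable A -> n A = pos_part n A - neg_part n A.
Proof.
by move=> mA; rewrite [LHS](jordan_decomp (svalP (projT2 (hahn_sets n))) mA)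
  /cadd/= cscaleN1.
Qed.

(** The identity [pos_part - neg_part = \d_1 - \d_0] with all terms moved to the
    side where they are positive, which makes it an equality of measures. *)
Lemma integral_unit_step (h : R -> \bar R) :
  measurable_fun [set: R] h -> (forall x, 0 <= h x) ->
  \int[pos_part unit_step]_x h x + h 0%R =
  \int[neg_part unit_step]_x h x + h 1%R.
Proof.
move=> mh h0.
have dirac_int (a : R) : \int[\d_a]_x h x = h a.
  by rewrite integral_dirac// diracT mul1e.
rewrite -(dirac_int 0%R) -(dirac_int 1%R) -!ge0_integral_measure_add//.
apply: eq_measure_integral => B mB _.
rewrite [LHS]measure_addE [RHS]measure_addE.
have := charge_pos_neg_part unit_step mB; rewrite /unit_step /cadd /copp/=.
set p := pos_part _ B; set n := neg_part _ B.
have : p \is a fin_num by exact: fin_num_measure.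
have : n \is a fin_num by exact: fin_num_measure.
rewrite /charge_of_finite_measure/= !diracE.
move: p n => [p| |] [n| |]// _ _ /= [].
rewrite !indicE => e; congr EFin; lra.
Qed.

Lemma conv_measureE (m1 m2 : {finite_measure set R -> \bar R}) (A : set R) :
  conv_measure m1 m2 A = \int[m1]_x m2 [set y | A (x + y)%R].
Proof.
by apply: eq_integral => x _; rewrite /= xsectionE.
Qed.

(** With [m] split into its two parts, [integral_unit_step] applies to the
    function [x |-> m2 (A - x)] for each part [m2]; the four products of parts
    then recombine. *)
Lemma conv_unit_step (m : {charge set R -> \bar R}) (A : set R) : measurable A ->
  Defs.conv unit_step m A = m [set y | A (1 + y)%R] - m A.
Proof.
move=> mA.
have mS (x : R) : measurable [set y | A (x + y)%R].
  rewrite -[X in measurable X]setTI.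
  exact: (@measurable_funD _ _ _ setT (cst x) id).
(* Written with sums on both sides so that only nonnegative functions are
   integrated. *)
have shift (m2 : {finite_measure set R -> \bar R}) :
    conv_measure (pos_part unit_step) m2 A + m2 A =
    conv_measure (neg_part unit_step) m2 A + m2 [set y | A (1 + y)%R].
  rewrite !conv_measureE.
  have {2}-> : A = [set y | A (0 + y)%R].
    by apply/seteqP; split=> y /=; rewrite add0r.
  apply: (@integral_unit_step (fun x => m2 [set y | A (x + y)%R])) => //.
  have mA2 : measurable [set z : R * R | A (z.1 + z.2)%R].
    by rewrite -[X in measurable X]setTI; exact: measurable_addR.
  have := measurable_fun_xsection m2 mA2; congr measurable_fun.
  by apply/funext => x; rewrite /= xsectionE.
have := shift (pos_part m); have := shift (neg_part m).
rewrite (charge_pos_neg_part m mA) (charge_pos_neg_part m (mS 1%R)).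
have -> : Defs.conv unit_step m A =
    conv_measure (pos_part unit_step) (pos_part m) A +
    conv_measure (neg_part unit_step) (neg_part m) A -
    (conv_measure (pos_part unit_step) (neg_part m) A +
     conv_measure (neg_part unit_step) (pos_part m) A) by [].
have fin (m2 : {finite_measure set R -> \bar R}) B :
    measurable B -> m2 B \is a fin_num.
  exact: fin_num_measure.
have cfin (m1 m2 : {finite_measure set R -> \bar R}) :
    conv_measure m1 m2 A \is a fin_num.
  exact: fin_num_measure.
move: (cfin (pos_part unit_step) (pos_part m)).
move: (cfin (pos_part unit_step) (neg_part m)).
move: (cfin (neg_part unit_step) (pos_part m)).
move: (cfin (neg_part unit_step) (neg_part m)).
move: (fin (pos_part m) _ mA) (fin (pos_part m) _ (mS 1%R)).
move: (fin (neg_part m) _ mA) (fin (neg_part m) _ (mS 1%R)).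
do 8![case: (X in X \is a fin_num -> _) => [?| |]// _].
by move=> [e1] [e2]; congr EFin; lra.
Qed.

(** The translate of [A] by 1 turns [n |-> \1_A n] into [n |-> \1_A n.+1], so a
    further convolution is a further difference. *)
Lemma conv_pow_unit_step q (A : set R) : measurable A ->
  conv_pow unit_step q A = (iter q (@fdiff R) (fun n => \1_A n%:R) 0%N)%:E.
Proof.
elim: q A => [|q IHq] A mA.
  by rewrite /= /charge_of_finite_measure/= diracE indicE.
rewrite [LHS]conv_unit_step// !IHq//; last first.
  rewrite -[X in measurable X]setTI.
  exact: (@measurable_funD _ _ _ setT (cst 1%R) id).
rewrite -EFinB iterS /fdiff -fdiff_succ; congr (_ - _)%:E.
by congr (iter _ _ _ _); apply/funext => n; rewrite !indicE -natr1 addrC.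
Qed.

End convolution_with_unit_step.

Lemma eseries_finite (R : realType) (u : nat -> \bar R) n :
  (forall q, (n <= q)%N -> u q = 0%E) ->
  (\sum_(0 <= q <oo) u q = \sum_(q < n) u q)%E.
Proof.
move=> u0; apply: lim_near_cst => //; exists n => // m /= nm.
rewrite (@big_cat_nat _ _ _ n)//= [X in (_ + X)%E]big1_seq ?adde0 ?big_mkord// => q.
by rewrite mem_index_iota => /andP[_ /andP[/u0]].
Qed.

Lemma chi_law_expansion (R : realType) (N k l : nat) (A : set R) :
  (k <= N)%N -> (l <= N)%N -> measurable A ->
  chi_law N k l A = (\sum_(0 <= q <oo)
    (factorial_coeff R N k l q)%:E * conv_pow (unit_step R) q A)%E.
Proof.
move=> kN lN mA; rewrite chi_lawE (chi_mean_newton kN lN).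
under eq_eseriesr do rewrite conv_pow_unit_step// -EFinM.
rewrite (@eseries_finite _ _ N.+1) ?sumEFin// => q Nq.
by rewrite factorial_coeff_eq0// mul0r.
Qed.

(** * Exchanging limits with series and integrals *)

(** Dominated convergence for the counting measure on the integers. *)
Lemma tannery (R : realType) (a : nat -> nat -> R) (a0 b : nat -> R) :
  (forall n m, `|a n m| <= b m) ->
  (forall m, a n m @[n --> \oo] --> a0 m) ->
  cvgn (series b) ->
  (\sum_(0 <= m <oo) (a n m)%:E)%E @[n --> \oo] -->
  (\sum_(0 <= m <oo) (a0 m)%:E)%E.
Proof.
move=> ab aa0 cb.
have b0 m : 0 <= b m by exact: le_trans (normr_ge0 _) (ab 0%N m).
have bsum : (\sum_(0 <= m <oo) (b m)%:E < +oo)%E.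
  rewrite (_ : limn _ = (limn (series b))%:E) ?ltry// -EFin_lim//.
  by apply/congr_lim/funext => n /=; rewrite sumEFin.
have summ (c : nat -> R) :
    (forall m, `|c m| <= b m) -> summable [set: nat] (EFin \o c).
  move=> cb'; rewrite /summable -nneseries_esumT; last first.
    by move=> *; exact: abse_ge0.
  apply: le_lt_trans bsum.
  by apply: lee_nneseries => m _ //=; rewrite lee_fin.
(* The bound passes to the limit, so the limit series is summable too. *)
have a0b m : `|a0 m| <= b m.
  have cm : `|a n m| @[n --> \oo] --> `|a0 m|.
    by apply: cvg_norm; exact: aa0.
  rewrite -(cvg_lim _ cm)//; apply: limr_le; first by apply: cvgP cm.
  by apply: nearW => n; exact: ab.
rewrite -(@integral_count R (EFin \o a0)) ?summ//.
rewrite (_ : (fun n => _) =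
    (fun n => \int[counting]_m (a n m)%:E)%E); last first.
  by apply/funext => n; rewrite -integral_count// summ.
apply: (@dominated_cvg _ _ _ counting _ measurableT _ _ (EFin \o b)) => //.
- by move=> m _; apply: cvg_EFin; [exact: nearW|exact: aa0].
- apply/integrableP; split => //.
  under eq_integral do rewrite /= ger0_norm//.
  by rewrite integral_count// summ// => m; rewrite ger0_norm.
- by move=> n m _; rewrite lee_fin.
Qed.

Lemma integrable_nat (R : realType) (nu : {measure set nat -> \bar R})
    (g : nat -> R) (M : R) :
  (nu setT < +oo)%E -> (forall n, `|g n| <= M) ->
  nu.-integrable setT (EFin \o g).
Proof.
move=> nuT gM; apply: measurable_bounded_integrable => //.
exists M; split => [|x Mx n _ /=]; first exact: num_real.
exact: le_trans (gM n) (ltW Mx).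
Qed.

(** Countable additivity over the singletons. *)
Lemma integral_nat (R : realType) (nu : {measure set nat -> \bar R})
    (g : nat -> R) :
  nu.-integrable setT (EFin \o g) ->
  (\int[nu]_n (g n)%:E = \sum_(0 <= n <oo) (g n)%:E * nu [set n])%E.
Proof.
move=> ig.
have UT : \bigcup_n [set n] = [set: nat].
  by apply/seteqP; split => // n _; exists n.
rewrite -{1}UT integral_bigcup//; last 2 first.
- by move=> i j _ _ [n [/= -> ->]].
- by rewrite UT.
apply: eq_eseriesr => n _; rewrite -integral_cst//.
by apply: eq_integral => m; rewrite inE => /= ->.
Qed.

(** * Limits of the factorial moments *)

Section ratio_limits.
Variable R : realType.
Implicit Types k l : nat -> nat.

(** Truncated subtraction of a constant costs at most [q / n]. *)
Lemma cvg_divn_subn k (s : R) q :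
  (k n)%:R / n%:R @[n --> \oo] --> s -> (k n - q)%:R / n%:R @[n --> \oo] --> s.
Proof.
move=> ks.
have q0 : q%:R / n%:R @[n --> \oo] --> (q%:R * 0 : R).
  rewrite -(cvg_shiftS (fun n => q%:R / n%:R : R)).
  by apply: cvgM; [exact: cvg_cst|exact: cvg_harmonic].
rewrite mulr0 in q0.
apply: (@squeeze_cvgr _ _ _ _ (fun n => (k n)%:R / n%:R - q%:R / n%:R)
  (fun n => (k n)%:R / n%:R)) => //.
  near=> n; rewrite -mulrBl !ler_wpM2r ?invr_ge0// ?ler_nat ?leq_subr//.
  by rewrite lerBlDr -natrD ler_nat addnC -leq_subLR.
by rewrite -[X in _ --> X]subr0; exact: cvgB.
Unshelve. all: by end_near. Qed.

(** Each of the [q] factors [(k n - i) / (n - i)] tends to [s]. *)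
Lemma cvg_ffact_ratio k (s : R) q :
  (k n)%:R / n%:R @[n --> \oo] --> s ->
  (k n ^_ q)%:R / (n ^_ q)%:R @[n --> \oo] --> s ^+ q.
Proof.
move=> ks; elim: q => [|q IHq].
  by under eq_fun do rewrite !ffactn0 divr1; exact: cvg_cst.
have n1 : n%:R / n%:R @[n --> \oo] --> (1 : R).
  apply: (@cvg_trans _ (1 @[_ --> \oo])); last exact: cvg_cst.
  apply: near_eq_cvg; near=> n; rewrite divff// pnatr_eq0 -lt0n.
  by near: n; exact: nbhs_infty_gt.
have step : (k n - q)%:R / (n - q)%:R @[n --> \oo] --> s / 1.
  apply: (@cvg_trans _
    (((k n - q)%:R / n%:R) / ((n - q)%:R / n%:R) @[n --> \oo])); last first.
    apply: cvgM; first exact: cvg_divn_subn.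
    by apply: cvgV => //; exact: (@cvg_divn_subn id).
  apply: near_eq_cvg; near=> n.
  have n0 : n%:R != 0 :> R.
    by rewrite pnatr_eq0 -lt0n; near: n; exact: nbhs_infty_gt.
  by rewrite invfM invrK mulrACA mulVf// mulr1.
rewrite divr1 in step; rewrite exprSr.
apply: cvg_trans (cvgM IHq step); apply: near_eq_cvg.
by apply: nearW => n; rewrite !ffactnSr !natrM invfM mulrACA.
Unshelve. all: by end_near. Qed.

Lemma cvg_factorial_coeff k l (s t : R) q :
  (k n)%:R / n%:R @[n --> \oo] --> s -> (l n)%:R / n%:R @[n --> \oo] --> t ->
  factorial_coeff R n (k n) (l n) q @[n --> \oo] --> (s * t) ^+ q / q`!%:R.
Proof.
move=> ks lt; rewrite exprMn.
rewrite (_ : (fun n => _) = (fun n =>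
    (k n ^_ q)%:R / (n ^_ q)%:R * ((l n ^_ q)%:R / (n ^_ q)%:R) / q`!%:R)).
  by apply: cvgM; [apply: cvgM; exact: cvg_ffact_ratio|exact: cvg_cst].
apply/funext => n; rewrite /factorial_coeff; congr (_ / _).
rewrite -!bin_ffact !natrM !invfM.
have q0 : q`!%:R != 0 :> R by rewrite pnatr_eq0 -lt0n fact_gt0.
move: ('C(n, q)%:R^-1) => c.
by field.
Qed.

Lemma cvg_truncn_ratio (s : R) : 0 <= s ->
  (Num.truncn (s * n%:R))%:R / n%:R @[n --> \oo] --> s.
Proof.
move=> s0.
have inv0 : n%:R^-1 @[n --> \oo] --> (0 : R).
  by rewrite -(cvg_shiftS (fun n => n%:R^-1 : R)); exact: cvg_harmonic.
apply: (@squeeze_cvgr _ _ _ _ (fun n => s - n%:R^-1) (fun=> s)).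
- near=> n.
  have n0 : 0 < n%:R :> R by rewrite ltr0n; near: n; exact: nbhs_infty_gt.
  have /andP[le1 lt1] := truncn_itv (mulr_ge0 s0 (ltW n0)).
  rewrite ler_pdivrMr// le1 andbT ler_pdivlMr// mulrBl mulVf ?gt_eqF//.
  by rewrite lerBlDr natr1 ltW.
- by rewrite -[X in _ --> X]subr0; apply: cvgB => //; exact: cvg_cst.
- exact: cvg_cst.
Unshelve. all: by end_near. Qed.

End ratio_limits.

(** * The Poisson limit *)

Section poisson_limit.
Variable R : realType.

Definition chi_pmf N k l j : R := chi_mean N k l (fun n => (n == j)%:R).

Lemma factorial_coeff_ge0 N k l q : 0 <= factorial_coeff R N k l q.
Proof. by rewrite /factorial_coeff !mulr_ge0// invr_ge0 ?exprn_ge0. Qed.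

Lemma factorial_coeff_le N k l q : (k <= N)%N -> (l <= N)%N ->
  factorial_coeff R N k l q <= q`!%:R^-1.
Proof.
move=> kN lN; rewrite /factorial_coeff ler_piMl ?invr_ge0//.
have [->|CN0] := eqVneq ('C(N, q)) 0%N; first by rewrite expr0n invr0 mulr0.
rewrite ler_pdivrMr ?exprn_gt0 ?ltr0n ?lt0n// mul1r expr2.
by rewrite ler_pM// ler_nat leq_bin2l.
Qed.

Lemma chi_pmf_ge0 N k l j : 0 <= chi_pmf N k l j.
Proof. by rewrite mulr_ge0 ?invr_ge0// sumr_ge0. Qed.

(** The indicator of [chi = j] is at most ['C(chi, j)], whose mean is
    [factorial_coeff]. *)
Lemma chi_pmf_le N k l j : (k <= N)%N -> (l <= N)%N ->
  chi_pmf N k l j <= j`!%:R^-1.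
Proof.
move=> kN lN; apply: le_trans (factorial_coeff_le j kN lN).
rewrite -(chi_mean_bin R kN lN) ler_wpM2l ?invr_ge0// ler_sum// => s _.
by case: eqP => [->|_]; rewrite ?binn ?ler0n.
Qed.

Lemma bin_le_exp2 n m : ('C(n, m) <= 2 ^ n)%N.
Proof.
have [mn|nm] := leqP m n; last by rewrite bin_small.
rewrite -[2%N]/(1 + 1)%N expnDn (bigD1 (Ordinal (mn : (m < n.+1)%N)))//=.
by rewrite !exp1n !muln1 leq_addr.
Qed.

(** The terms with [q < j] vanish; those with [q = m + j] are [rate ^+ j / j`!]
    times the terms of the exponential series at [- rate]. *)
Lemma poisson_pmf_alternating (rate : R) j : 0 < rate ->
  (\sum_(0 <= q <oo) (rate ^+ q / q`!%:R * ((-1) ^+ (q + j) * 'C(q, j)%:R))%:E)%E =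
  (poisson_pmf rate j)%:E.
Proof.
move=> rate0; rewrite /poisson_pmf rate0.
apply: cvg_lim => //; rewrite -(cvg_shiftn j).
rewrite (_ : (fun n => _) =
    EFin \o (fun n => rate ^+ j / j`!%:R * series (exp_coeff (- rate)) n)).
  apply: cvg_EFin; first exact: nearW.
  by apply: cvgM; [exact: cvg_cst|exact: is_cvg_series_exp_coeff].
apply/funext => n /=; rewrite sumEFin; congr EFin.
rewrite (@big_cat_nat _ _ _ j)//= ?leq_addl//.
rewrite big1_seq ?add0r => [|q]; last first.
  by rewrite mem_index_iota => /andP[_ /andP[_ qj]]; rewrite bin_small// !mulr0.
rewrite -{1}[j]add0n big_addn addnK mulr_sumr; apply: eq_bigr => m _.
rewrite /exp_coeff/= exprD -addnA addnn exprD -mul2n exprM sqrrN !expr1n mulr1.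
have /(congr1 (fun n => n%:R : R)) := bin_fact (leq_addl m j).
rewrite addnK !natrM.
have f0 i : i`!%:R != 0 :> R by rewrite pnatr_eq0 -lt0n fact_gt0.
move=> <-; rewrite (exprNn rate); field.
by rewrite !f0 pnatr_eq0 -lt0n bin_gt0 leq_addl.
Qed.

(** Newton's expansion at the indicator of [j], with the coefficient of index [q]
    bounded by ['C(q, j) / q`! <= 2 ^+ q / q`!]. *)
Lemma cvg_chi_pmf (k l : nat -> nat) (s t : R) j :
  (forall n, (k n <= n)%N) -> (forall n, (l n <= n)%N) -> 0 < s * t ->
  (k n)%:R / n%:R @[n --> \oo] --> s -> (l n)%:R / n%:R @[n --> \oo] --> t ->
  chi_pmf n (k n) (l n) j @[n --> \oo] --> poisson_pmf (s * t) j.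
Proof.
move=> kn ln st0 ks lt.
have pmfE n : (chi_pmf n (k n) (l n) j)%:E =
    (\sum_(0 <= q <oo) (factorial_coeff R n (k n) (l n) q *
      ((-1) ^+ (q + j) * 'C(q, j)%:R))%:E)%E.
  rewrite (@eseries_finite _ _ n.+1) => [|q nq]; last first.
    by rewrite factorial_coeff_eq0// mul0r.
  rewrite sumEFin /chi_pmf (chi_mean_newton (kn n) (ln n)); congr EFin.
  by apply: eq_bigr => q _; rewrite fdiff_indicator.
apply: (@fine_cvg _ _ _ _ (fun n => (chi_pmf n (k n) (l n) j)%:E)).
under eq_fun do rewrite pmfE; rewrite -poisson_pmf_alternating//.
apply: (@tannery _ _ _ (exp_coeff 2)).
- move=> n q; rewrite normrM (ger0_norm (factorial_coeff_ge0 _ _ _ _)).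
  rewrite normrM normrX normrN1 expr1n mul1r ger0_norm// mulrC /exp_coeff/=.
  rewrite ler_pM ?factorial_coeff_ge0 ?factorial_coeff_le//.
  by rewrite -natrX ler_nat bin_le_exp2.
- by move=> q; apply: cvgM; [exact: cvg_factorial_coeff|exact: cvg_cst].
- exact: is_cvg_series_exp_coeff.
Qed.

Lemma integral_pushforward_natr (mu : {measure set R -> \bar R})
    (nu : {measure set nat -> \bar R}) (f : R -> R) (M : R) :
  (forall A, measurable A -> mu A = nu [set n | A n%:R]) ->
  (nu setT < +oo)%E -> measurable_fun [set: R] f -> (forall x, `|f x| <= M) ->
  (\int[mu]_x (f x)%:E = \sum_(0 <= n <oo) (f n%:R)%:E * nu [set n])%E.
Proof.
move=> munu nuT mf fM.
have ig := integrable_nat nuT (fun n => fM n%:R); rewrite -integral_nat//.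
rewrite (eq_measure_integral
  (pushforward_measure nu (@measurable_natr R))) => [|A mA _]; last exact: munu.
by rewrite integral_pushforward//; exact/measurable_EFinP.
Qed.

Lemma integral_chi_law N k l (f : R -> R) (M : R) :
  measurable_fun [set: R] f -> (forall x, `|f x| <= M) ->
  (\int[chi_law N k l]_x (f x)%:E =
   \sum_(0 <= n <oo) (f n%:R * chi_pmf N k l n)%:E)%E.
Proof.
move=> mf fM.
pose nu := @pushforward_measure _ _ (pperm N) nat R
  (uniform_kappa N k) (chi l) (fun _ _ _ => I).
have nuE A : nu A = (chi_mean N k l (fun n => \1_A n))%:E.
  exact: uniform_kappaE.
rewrite (@integral_pushforward_natr _ nu f M)//; last by rewrite nuE ltry.
apply: eq_eseriesr => n _; rewrite nuE -EFinM; congr (_ * chi_mean _ _ _ _)%:E.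
apply/funext => m; rewrite indicE; congr (_%:R).
by congr nat_of_bool; apply/idP/eqP; rewrite inE.
Qed.

Lemma integral_poisson_law (rate : R) (f : R -> R) (M : R) : 0 < rate ->
  measurable_fun [set: R] f -> (forall x, `|f x| <= M) ->
  (\int[poisson_law rate]_x (f x)%:E =
   \sum_(0 <= n <oo) (f n%:R * poisson_pmf rate n)%:E)%E.
Proof.
move=> rate0 mf fM.
rewrite (@integral_pushforward_natr _ (poisson_prob rate 0) f M)//; last first.
  rewrite [X in (X < _)%E](@probability_setT _ _ _ (poisson_prob rate 0)).
  exact: ltry.
have pmfE n : poisson_prob rate 0 [set n] = (poisson_pmf rate n)%:E.
  by rewrite /poisson_prob rate0 esum_set1// lee_fin poisson_pmf_ge0.
by apply: eq_eseriesr => n _; rewrite EFinM -pmfE.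
Qed.

(** With [`|f| <= M] the [j]-th term of the integral is at most [M / j`!],
    uniformly in [n]. *)
Lemma chi_law_cvg_poisson (k l : nat -> nat) (s t : R) :
  (forall n, (k n <= n)%N) -> (forall n, (l n <= n)%N) -> 0 < s * t ->
  (k n)%:R / n%:R @[n --> \oo] --> s -> (l n)%:R / n%:R @[n --> \oo] --> t ->
  cvg_in_law \oo (fun n => chi_law n (k n) (l n)) (poisson_law (s * t)).
Proof.
move=> kn ln st0 ks lt f cf [M0 [_ fM0]].
(* Boundedness provides bounds strictly above [M0] only. *)
have fM x : `|f x| <= M0 + 1 by apply: fM0 => //; rewrite ltrDl.
have mf : measurable_fun [set: R] f by exact: continuous_measurable_fun.
rewrite (integral_poisson_law st0 mf fM).
under eq_fun do rewrite (integral_chi_law _ _ _ mf fM).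
apply: (@tannery _ _ _ (fun j => (M0 + 1) * exp_coeff 1 j)).
- move=> n j; rewrite normrM (ger0_norm (chi_pmf_ge0 _ _ _ _)).
  by rewrite ler_pM ?chi_pmf_ge0// /exp_coeff/= expr1n mul1r chi_pmf_le.
- by move=> j; apply: cvgM; [exact: cvg_cst|exact: cvg_chi_pmf].
- exact/is_cvg_seriesZ/is_cvg_series_exp_coeff.
Qed.

End poisson_limit.

Theorem theorem1p6 (R : realType) :
  (forall N k l : nat, (k <= N)%N -> (l <= N)%N ->
    forall A : set R, measurable A ->
      chi_law N k l A =
      (\sum_(0 <= q <oo)
        ('C(k, q)%:R * 'C(l, q)%:R * 'C(N, q)%:R ^- 2 / q`!%:R)%:E *
        conv_pow (cadd (charge_of_finite_measure \d_(1%R : R))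
                       (copp (charge_of_finite_measure \d_(0%R : R)))) q A)%E)
  /\
  (forall s t : R, 0 < s <= 1 -> 0 < t <= 1 ->
    cvg_in_law
      (within [set N : nat | s * N%:R \is a Num.int /\ t * N%:R \is a Num.int]
        \oo)
      (fun N => chi_law N (Num.truncn (s * N%:R)) (Num.truncn (t * N%:R)))
      (poisson_law (s * t))).
Proof.
split=> [N k l kN lN A mA|s t /andP[s0 s1] /andP[t0 t1] f cf bf].
  exact: chi_law_expansion.
have le_trunc (r : R) : r <= 1 -> forall n, (Num.truncn (r * n%:R) <= n)%N.
  move=> r1 n; rewrite truncn_le_nat (@le_lt_trans _ _ n%:R) ?ltr_nat//.
  by rewrite ler_piMl.
apply: cvg_within_filter.
apply: (@chi_law_cvg_poisson _ _ _ s t) => //.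
- exact: le_trunc.
- exact: le_trunc.
- exact: mulr_gt0.
- exact/cvg_truncn_ratio/ltW.
- exact/cvg_truncn_ratio/ltW.
Qed.
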